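(* Let $\mathcal{X}\subseteq\mathbb{R}^n$, let $\mathcal{Y}\subseteq\{y\in\mathbb{R}^m:\sum_{j=1}^m y_j=1,\ y\ge0\}$, $\mathcal{Z}=\mathcal{X}\times\mathcal{Y}$, and let $d(z',z)=\|x'-x\|_r+\kappa\|y'-y\|_1$ for $z=(x,y)$, $z'=(x',y')$, where $r\in[1,\infty]$ and $\kappa\in(0,\infty)\cup\{\infty\}$. Let $f_\theta:\mathcal{X}\to\mathbb{R}^m$ and define $\bm{l}(x,y;\theta)=\langle y,f_\theta(x)\rangle$. Suppose $F_\theta$ is an adversarial score of $f_\theta$. (a) If $\kappa=\infty$, then $\mathcal{A}_\theta(t):=F_\theta(t)$ is an adversarial score of $\bm{l}(\cdot;\theta)$. (b) If $\kappa\in(0,\infty)$ and there is $M\in(0,\infty)$ such that $\|f_\theta(x)\|_\infty\le M$ for all $x\in\mathcal{X}$, then $\mathcal{A}_\theta(t):=\sup_{\tau\in[0,t]}\{F_\theta(t-\tau)+M\kappa^{-1}\tau\}$ is an adversarial score of $\bm{l}(\cdot;\theta)$.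
   Context: Convention: $0\cdot\infty=0$ (so for $\kappa=\infty$, $d(z',z)\le t<\infty$ iff $y'=y$ and $\|x'-x\|_r\le t$). $\|\cdot\|_r$ is the $r$-norm. Adversarial score: for $f:\mathcal{X}\subseteq\mathbb{R}^n\to\mathbb{R}^{\tilde n}$ put $\Delta_f(x,t)=\sup_{x'\in\mathcal{X}}\{\|f(x')-f(x)\|_r:\|x'-x\|_r\le t\}$. A function $F:[0,\infty)\to[0,\infty)$ is an adversarial score of $f$ if $F$ is non-decreasing and concave and $\sup_{x\in\mathcal{X}}\Delta_f(x,t)\le F(t)$ for all $t\ge0$. For the real-valued loss $\bm{l}(\cdot;\theta)$ on $(\mathcal{Z},d)$, an adversarial score is a non-decreasing concave $\mathcal{A}:[0,\infty)\to[0,\infty)$ with $\sup\{|\bm{l}(z';\theta)-\bm{l}(z;\theta)|: z,z'\in\mathcal{Z},\ d(z',z)\le t\}\le\mathcal{A}(t)$ for all $t\ge0$. *)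

(* Defs.v *)
From HB Require Import structures.
From mathcomp Require Import all_boot all_order all_algebra.
From mathcomp Require Import all_classical all_reals all_analysis.

Set Implicit Arguments.
Unset Strict Implicit.
Unset Printing Implicit Defensive.

Import Order.TTheory GRing.Theory Num.Theory.
Import numFieldNormedType.Exports.

Local Open Scope classical_set_scope.
Local Open Scope ring_scope.

(* The norm of the library on matrices is the maximum of the absolute values
   of the entries. The norm is meant for 1 <= r; the value at -oo is junk. *)
Definition rnorm (R : realType) (r : \bar R) (n : nat) (x : 'rV[R]_n) : R :=
  match r with
  | p%:E => (\sum_(j < n) `|x 0 j| `^ p) `^ p^-1
  | +oo%E => `|x|
  | -oo%E => 0
  end.

Definition prob_simplex (R : realType) (m : nat) : set 'rV[R]_m :=
  [set y | \sum_(j < m) y 0 j = 1 /\ forall j, 0 <= y 0 j].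
Arguments prob_simplex {R} m.

(* The library sets +oo * 0 = 0, which is the convention used for
   kappa = +oo. *)
Definition cost (R : realType) (r kappa : \bar R) (n m : nat)
    (w z : 'rV[R]_n * 'rV[R]_m) : \bar R :=
  ((rnorm r (w.1 - z.1))%:E + kappa * (rnorm 1%:E (w.2 - z.2))%:E)%E.
Arguments cost {R} r kappa {n m} w z.

(* f is only evaluated on X, so the values of the total function f outside X
   are irrelevant. *)
Definition Delta (R : realType) (r : \bar R) (n k : nat) (X : set 'rV[R]_n)
    (f : 'rV[R]_n -> 'rV[R]_k) (x : 'rV[R]_n) (t : R) : \bar R :=
  ereal_sup [set (rnorm r (f x' - f x))%:E |
    x' in X `&` [set x' | rnorm r (x' - x) <= t]].

Definition concave_function (R : realType) (D : set R) (F : R -> R) : Prop :=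
  @convex_function R R^o D (\- F).

(* A function [0, +oo) -> [0, +oo) is represented by a total function on R of
   which only the restriction to [0, +oo) matters. *)
Definition score_function (R : realType) (F : R -> R) : Prop :=
  [/\ forall t, 0 <= t -> 0 <= F t,
      {in `[0, +oo[ &, nondecreasing_fun F} &
      concave_function `[0, +oo[ F].

Definition adversarial_score (R : realType) (r : \bar R) (n k : nat)
    (X : set 'rV[R]_n) (f : 'rV[R]_n -> 'rV[R]_k) (F : R -> R) : Prop :=
  score_function F /\
  forall t, 0 <= t ->
    (ereal_sup [set Delta r X f x t | x in X] <= (F t)%:E)%E.

Definition loss_adversarial_score (R : realType) (T : Type) (Z : set T)
    (d : T -> T -> \bar R) (l : T -> R) (A : R -> R) : Prop :=
  score_function A /\
  forall t, 0 <= t ->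
    (ereal_sup [set e | exists w z, [/\ Z w, Z z, d w z <= t%:E &
                                        e = `|l w - l z|%:E]] <= (A t)%:E)%E.

Definition inner_loss (R : realType) (n m : nat) (f : 'rV[R]_n -> 'rV[R]_m)
    (z : 'rV[R]_n * 'rV[R]_m) : R :=
  \sum_(j < m) z.2 0 j * f z.1 0 j.

(* Main.v *)
(* For z = (x, y) and z' = (x', y'), split
     l(z') - l(z) = <y', f(x') - f(x)> + <y' - y, f(x)>.
   As y' is a probability vector, the first term is at most the largest entry
   of |f(x') - f(x)|, which every r-norm dominates; the second is at most
   M ||y' - y||_1. If kappa = +oo, finite cost forces y' = y. Otherwise the
   bound is a term of the supremum, with tau = kappa ||y' - y||_1, and this
   supremum is a sup-convolution of concave functions, hence concave. *)
Require Import Defs.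
From mathcomp Require Import all_boot all_order all_algebra.
From mathcomp Require Import all_classical all_reals all_analysis.
From mathcomp Require Import ring lra.

Set Implicit Arguments.
Unset Strict Implicit.
Unset Printing Implicit Defensive.

Import Order.TTheory GRing.Theory Num.Theory.
Import numFieldNormedType.Exports.
Local Open Scope classical_set_scope.
Local Open Scope ring_scope.

(** Trades the library form of concavity, with a bundled weight in the unit interval and scaling on
    [R^o], for a real inequality in two weights that [ring] and [lra] can handle. *)
Lemma concave_nnegP (R : realType) (F : R -> R) :
  concave_function `[0, +oo[ F <->
  forall p q x y : R, 0 <= p -> 0 <= q -> p + q = 1 -> 0 <= x -> 0 <= y ->
    p * F x + q * F y <= F (p * x + q * y).
Proof.
split=> [cF p q x y p0 q0 pq x0 y0 | cF p x y].
- have p1 : p <= 1 by lra.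
  have xD : (x : R^o) \in (`[0, +oo[%classic : set R^o).
    by rewrite inE /= in_itv /= x0.
  have yD : (y : R^o) \in (`[0, +oo[%classic : set R^o).
    by rewrite inE /= in_itv /= y0.
  have : - F (p * x + unstable.onem p * y) <=
      p * - F x + unstable.onem p * - F y.
    exact: (cF (Itv01 p0 p1) x y xD yD).
  rewrite /unstable.onem.
  rewrite (_ : 1 - p = q); last lra.
  by rewrite !mulrN -opprD lerN2.
- move=> /set_mem; rewrite /= in_itv /= andbT => x0.
  move=> /set_mem; rewrite /= in_itv /= andbT => y0.
  change (- F (p%:num * x + unstable.onem p%:num * y) <=
    p%:num * - F x + unstable.onem p%:num * - F y).
  have p0 : 0 <= p%:num by [].
  have p1 : p%:num <= 1 by [].
  have := cF p%:num (unstable.onem p%:num) x y p0.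
  rewrite /unstable.onem subr_ge0 => /(_ p1) /(_ _ x0 y0).
  by rewrite addrCA subrr addr0 !mulrN -opprD lerN2 => /(_ erefl).
Qed.

(** For finite exponent [p], the power [|x 0 j| ^ p] is one term of a sum of nonnegative terms, and
    the power [p^-1] is monotone. For [+oo] the norm is a maximum over the entries. *)
Lemma entry_le_rnorm (R : realType) (r : \bar R) (n : nat) (x : 'rV[R]_n)
    (j : 'I_n) : (1%:E <= r)%E -> `|x 0 j| <= rnorm r x.
Proof.
case: r => [p| |] //= => [|_]; last first.
  rewrite [leRHS]mx_normrE.
  exact: (le_bigmax _ (fun ij : 'I_1 * 'I_n => `|x ij.1 ij.2|) (0, j)).
rewrite lee_fin => p1.
have p0 : p != 0 by lra.
have -> : `|x 0 j| = (`|x 0 j| `^ p) `^ p^-1.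
  by rewrite -powRrM mulfV // powRr1.
apply: ge0_ler_powR; rewrite ?invr_ge0 ?nnegrE; first by lra.
- exact: powR_ge0.
- by apply: sumr_ge0 => i _; exact: powR_ge0.
- by rewrite (bigD1 j) //= lerDl; apply: sumr_ge0 => i _; exact: powR_ge0.
Qed.

Lemma rnorm_ge0 (R : realType) (r : \bar R) (n : nat) (x : 'rV[R]_n) :
  0 <= rnorm r x.
Proof. by case: r => [p| |] //=; exact: powR_ge0. Qed.

Lemma rnorm1E (R : realType) (n : nat) (x : 'rV[R]_n) :
  rnorm 1%:E x = \sum_j `|x 0 j|.
Proof.
rewrite /= invr1 powRr1; last by apply: sumr_ge0 => i _; exact: powR_ge0.
by apply: eq_bigr => j _; rewrite powRr1.
Qed.

(** The bound [M] concerns [f] at the single point [z.1], so that the lemma serves both infinite and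
    finite [kappa]. *)
Lemma inner_loss_dist (R : realType) (n m : nat) (f : 'rV[R]_n -> 'rV[R]_m)
    (w z : 'rV[R]_n * 'rV[R]_m) (c M : R) :
  prob_simplex m w.2 -> (forall j, `|(f w.1 - f z.1) 0 j| <= c) ->
  (forall j, `|f z.1 0 j| <= M) ->
  `|inner_loss f w - inner_loss f z| <= c + M * rnorm 1%:E (w.2 - z.2).
Proof.
move=> [w1 w0] hc hM.
have -> : inner_loss f w - inner_loss f z =
    \sum_j w.2 0 j * (f w.1 - f z.1) 0 j + \sum_j (w.2 - z.2) 0 j * f z.1 0 j.
  rewrite /inner_loss -sumrB -big_split /=; apply: eq_bigr => j _.
  by rewrite !mxE; ring.
rewrite (le_trans (ler_normD _ _))// lerD//.
- rewrite (le_trans (ler_norm_sum _ _ _))//.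
  (* The weights [w.2] sum to 1, so [c] is their weighted sum of copies of [c]. *)
  rewrite -[leRHS]mul1r -w1 mulr_suml; apply: ler_sum => j _.
  by rewrite normrM ger0_norm // ler_wpM2l.
- rewrite (le_trans (ler_norm_sum _ _ _))// rnorm1E mulr_sumr.
  by apply: ler_sum => j _; rewrite normrM mulrC ler_wpM2r.
Qed.

Lemma adversarial_score_rnorm (R : realType) (r : \bar R) (n k : nat)
    (X : set 'rV[R]_n) (f : 'rV[R]_n -> 'rV[R]_k) (F : R -> R)
    (x x' : 'rV[R]_n) (t : R) :
  adversarial_score r X f F -> X x -> X x' -> rnorm r (x' - x) <= t ->
  rnorm r (f x' - f x) <= F t.
Proof.
move=> [_ hF] Xx Xx' xt.
have /hF : 0 <= t by exact: le_trans (rnorm_ge0 _ _) xt.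
rewrite -lee_fin; apply: le_trans.
apply: (@le_trans _ _ (Delta r X f x t)).
  by apply: ereal_sup_ubound; exists x'.
by apply: ereal_sup_ubound; exists x.
Qed.

Section sup_convolution.
Variables (R : realType) (F : R -> R) (c : R).
Hypotheses (sF : score_function F) (c0 : 0 <= c).

Let vals (t : R) := [set F (t - tau) + c * tau | tau in `[0, t]].
Let A (t : R) := sup (vals t).

Let F_nondecreasing s t : 0 <= s -> s <= t -> F s <= F t.
Proof.
case: (sF) => _ hF _ s0 st.
by apply: hF => //; rewrite in_itv /= andbT // (le_trans s0).
Qed.

(** The real-valued [sup] is meaningful only for a nonempty set that is bounded above. Here
    [tau = 0] gives an element, and monotonicity of [F] with [0 <= c] gives the bound
    [F t + c * t]. *)
Lemma sup_convolution_has_sup t : 0 <= t -> has_sup (vals t).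
Proof.
move=> t0; split.
  by exists (F (t - 0) + c * 0), 0 => //=; rewrite in_itv /= lexx.
exists (F t + c * t) => v [tau /=]; rewrite in_itv /= => /andP[tau0 taut] <-.
rewrite lerD ?ler_wpM2l//.
by apply: F_nondecreasing; lra.
Qed.

Lemma le_sup_convolution t tau :
  0 <= tau -> tau <= t -> F (t - tau) + c * tau <= A t.
Proof.
move=> tau0 taut; apply: ub_le_sup.
  by have [] := sup_convolution_has_sup (le_trans tau0 taut).
by exists tau => //=; rewrite in_itv /= tau0.
Qed.

Lemma sup_convolution_score : score_function A.
Proof.
case: (sF) => F0 _ /concave_nnegP cF; split.
(* The term with [tau = 0] is [F t]. *)
- move=> t t0; apply: (le_trans _ (le_sup_convolution (lexx 0) t0)).
  by rewrite mulr0 addr0 subr0 F0.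
- move=> s t; rewrite !in_itv /= !andbT => s0 t0 st.
  apply: ge_sup => [|v [tau /=]]; first by have [] := sup_convolution_has_sup s0.
  rewrite in_itv /= => /andP[tau0 taus] <-.
  (* The same [tau] is admissible for the larger [t], and [F (s - tau) <= F (t - tau)]. *)
  apply: (le_trans _ (le_sup_convolution tau0 (le_trans taus st))).
  by rewrite lerD2r; apply: F_nondecreasing; lra.
- apply/concave_nnegP => p q x y p0 q0 pq x0 y0.
  (* The suprema need not be attained, so [a] and [b] are chosen optimal up to [e] for [x] and [y].
     Their combination [p * a + q * b] is then admissible at [p * x + q * y]. *)
  apply/ler_addgt0Pr => e e0.
  have [u [a /=] + <- ha] := sup_adherent e0 (sup_convolution_has_sup x0).
  rewrite in_itv /= => /andP[a0 ax].
  have [v [b /=] + <- hb] := sup_adherent e0 (sup_convolution_has_sup y0).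
  rewrite in_itv /= => /andP[b0 by_].
  have tau0 : 0 <= p * a + q * b by rewrite addr_ge0 ?mulr_ge0.
  have taut : p * a + q * b <= p * x + q * y by rewrite lerD ?ler_wpM2l.
  have := le_sup_convolution tau0 taut.
  have := cF p q (x - a) (y - b) p0 q0 pq.
  rewrite !subr_ge0 => /(_ ax by_).
  have -> : p * (x - a) + q * (y - b) = p * x + q * y - (p * a + q * b) by ring.
  have := ler_wpM2l p0 (ltW ha); have := ler_wpM2l q0 (ltW hb).
  rewrite -/(A x) -/(A y).
  (* With this substitution the errors [p * e] and [q * e] add up to [e]. *)
  have -> : q = 1 - p by lra.
  by lra.
Qed.

End sup_convolution.

Theorem proposition2 (R : realType) (n m : nat)
    (X : set 'rV[R]_n) (Y : set 'rV[R]_m)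
    (hY : Y `<=` prob_simplex m)
    (r kappa : \bar R) (hr : (1%:E <= r)%E) (hkappa : (0%:E < kappa)%E)
    (Theta : Type) (f : Theta -> 'rV[R]_n -> 'rV[R]_m)
    (F : Theta -> R -> R) (theta : Theta)
    (hF : adversarial_score r X (f theta) (F theta)) :
  (kappa = +oo%E ->
     loss_adversarial_score (X `*` Y) (cost r kappa) (inner_loss (f theta))
       (F theta)) /\
  ((kappa < +oo)%E -> forall M : R, 0 < M ->
     (forall x, X x -> rnorm +oo%E (f theta x) <= M) ->
     loss_adversarial_score (X `*` Y) (cost r kappa) (inner_loss (f theta))
       (fun t => sup [set F theta (t - tau) + M * (fine kappa)^-1 * tau |
                      tau in `[0, t]])).
Proof.
have fj x x' t : X x -> X x' -> rnorm r (x' - x) <= t ->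
    forall j, `|(f theta x' - f theta x) 0 j| <= F theta t.
  move=> Xx Xx' xt j.
  exact: le_trans (entry_le_rnorm _ _ hr) (adversarial_score_rnorm hF Xx Xx' xt).
have sF : score_function (F theta) by case: hF.
split=> [-> | kfin M M0 hM].
- split=> // t t0; apply: ge_ereal_sup => _ [w [z [[Xw Yw] [Xz Yz] + ->]]].
  rewrite /cost lee_fin.
  (* If the label distance is zero, the convention [+oo * 0 = 0] leaves only the distance in [X]. If
     it is positive, the cost is infinite and cannot be at most [t]. *)
  have := rnorm_ge0 1%:E (w.2 - z.2); rewrite le_eqVlt => /predU1P[|] s0.
    rewrite -s0 mule0 adde0 lee_fin => wt.
    (* The maximum norm of [f theta z.1] serves as [M]; its factor is the zero label distance, so
       its size is irrelevant. *)
    have := inner_loss_dist (hY _ Yw) (fj _ _ _ Xz Xw wt)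
      (fun j => entry_le_rnorm (f theta z.1) j (leey 1%:E)).
    by rewrite -s0 mulr0 addr0.
  by rewrite gt0_mulye ?lte_fin.
- case: kappa hkappa kfin => [k| |] //=; rewrite lte_fin => k0 _.
  have c0 : 0 <= M * k^-1 by rewrite mulr_ge0 ?invr_ge0 // ltW.
  split; first exact: sup_convolution_score.
  move=> t t0; apply: ge_ereal_sup => _ [w [z [[Xw Yw] [Xz Yz] + ->]]].
  rewrite /cost -EFinM -EFinD !lee_fin.
  set s := rnorm 1%:E _ => wt.
  have s0 : 0 <= k * s by rewrite mulr_ge0 ?rnorm_ge0 // ltW.
  have ts : rnorm r (w.1 - z.1) <= t - k * s by lra.
  have st : k * s <= t by have := rnorm_ge0 r (w.1 - z.1); lra.
  (* The choice [tau = k * s] is the label share of the cost. It leaves the budget [t - k * s] for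
     the move in [X], and [M * k^-1 * tau] becomes [M * s]. *)
  apply: (le_trans _ (le_sup_convolution sF c0 s0 st)).
  rewrite -mulrA mulKf ?gt_eqF //.
  apply: inner_loss_dist (hY _ Yw) (fj _ _ _ Xz Xw ts) _ => j.
  exact: le_trans (entry_le_rnorm _ _ (leey 1%:E)) (hM _ Xz).
Qed.
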